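(* Let $A\in\mathbb{R}^{r\times n}$, $B\in\mathbb{R}^{m\times n}$, $\lambda>0$, $p>0$, and let $\{\gamma^k>0: k\in\mathbb{N}\}$ be an increasing sequence going to infinity. Let $f:\mathbb{R}^r\rightarrow\mathbb{R}\cup\{+\infty\}$ be proper, lower semicontinuous, level bounded and bounded below, and let $\phi:=f\circ A$ (i.e. $\phi(x)=f(Ax)$) be proper. For $x\in\mathbb{R}^n$ and $\gamma>0$ put $$\Phi(x):=\phi(x)+\lambda\|Bx\|_0,\qquad \Psi_\gamma(x):=\phi(x)+\lambda\psi_\gamma(Bx).$$ Then the following statements hold: (i) $\min\Psi_{\gamma^k}\rightarrow\min\Phi$ as $k\rightarrow+\infty$. (ii) $\limsup_k(\arg\min\Psi_{\gamma^k})\subseteq\arg\min\Phi$. (iii) If, for each $k\in\mathbb{N}$, $x^k$ is a global minimizer of $\Psi_{\gamma^k}$, then any cluster point of $\{x^k:k\in\mathbb{N}\}$ is a global minimizer of $\Phi$.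
   Context: $\|y\|_0$ denotes the number of nonzero entries of $y$. For $p>0$, $\gamma>0$, $\psi_\gamma(y)=\sum_{i=1}^m\varphi_\gamma(y_i)$ for $y\in\mathbb{R}^m$, where $\varphi_\gamma(t)=\min(\gamma|t|^p,1)$. A function with values in $\mathbb{R}\cup\{+\infty\}$ is proper if it is not identically $+\infty$; a proper function $f$ is level bounded if $\lim_{\|x\|_2\to+\infty}f(x)=+\infty$. All minima and argmins are over $\mathbb{R}^n$. For a sequence of sets $S_k\subseteq\mathbb{R}^n$, $\limsup_k S_k$ is the outer limit: the set of all $x$ for which there are indices $k_1<k_2<\cdots$ and points $x_j\in S_{k_j}$ with $x_j\to x$. *)

(* Defs.v *)
(* MathComp-Analysis over an arbitrary [R : realType]; vectors of R^n are
   column vectors ['cV[R]_n], with the library's (product) topology. *)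
From mathcomp Require Import all_boot all_order all_algebra.
From mathcomp Require Import all_classical all_reals all_analysis.

Set Implicit Arguments.
Unset Strict Implicit.
Unset Printing Implicit Defensive.

Import Order.TTheory GRing.Theory Num.Theory.
Import numFieldNormedType.Exports.

Local Open Scope classical_set_scope.
Local Open Scope ring_scope.

(* The library norm on matrices is the max norm, hence this definition. *)
Definition l2norm (R : realType) (n : nat) (x : 'cV[R]_n) : R :=
  Num.sqrt (\sum_(i < n) (x i 0) ^+ 2).

Definition l0norm (R : realType) (m : nat) (y : 'cV[R]_m) : nat :=
  #|[pred i : 'I_m | y i 0 != 0]|.

(* Since [0 < p] in all uses, [0 `^ p = 0] as expected. *)
Definition capped (R : realType) (p gamma t : R) : R :=
  Num.min (gamma * (`|t| `^ p)) 1.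

Definition capped_sum (R : realType) (m : nat) (p gamma : R) (y : 'cV[R]_m) : R :=
  \sum_(i < m) capped p gamma (y i 0).

(* [\bar R] also contains -oo; a function into R U {+oo} is an [f : T -> \bar R]
   that avoids -oo. *)
Definition no_ninfty (T : Type) (R : realType) (f : T -> \bar R) : Prop :=
  forall x, f x != -oo%E.

Definition proper_fun (T : Type) (R : realType) (f : T -> \bar R) : Prop :=
  exists x, f x != +oo%E.

Definition level_bounded (R : realType) (n : nat) (f : 'cV[R]_n -> \bar R) : Prop :=
  forall M : R, exists K : R, forall x, K < l2norm x -> (M%:E < f x)%E.

Definition bounded_below (T : Type) (R : realType) (f : T -> \bar R) : Prop :=
  exists c : R, forall x, (c%:E <= f x)%E.

Definition argmin (T : Type) (R : realType) (f : T -> \bar R) : set T :=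
  [set x | forall y, (f x <= f y)%E].

(* [v] is the minimum of [f]: an attained lower bound of its values. *)
Definition is_min (T : Type) (R : realType) (f : T -> \bar R) (v : \bar R) : Prop :=
  range f v /\ lbound (range f) v.

(* Painleve-Kuratowski outer limit; not the set-theoretic [lim_sup_set]. *)
Definition outer_limit (T : topologicalType) (S : nat -> set T) : set T :=
  [set x | exists (s : nat -> nat) (u : nat -> T),
    [/\ forall i j, (i < j)%N -> (s i < s j)%N,
        forall j, S (s j) (u j)
      & u @ \oo --> x]].

Definition obj_phi (R : realType) (r n : nat) (f : 'cV[R]_r -> \bar R)
    (A : 'M[R]_(r, n)) : 'cV[R]_n -> \bar R :=
  fun x => f (A *m x).

Definition obj_Phi (R : realType) (r m n : nat) (f : 'cV[R]_r -> \bar R)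
    (A : 'M[R]_(r, n)) (B : 'M[R]_(m, n)) (lambda : R) : 'cV[R]_n -> \bar R :=
  fun x => (obj_phi f A x + (lambda * (l0norm (B *m x))%:R)%:E)%E.

Definition obj_Psi (R : realType) (r m n : nat) (f : 'cV[R]_r -> \bar R)
    (A : 'M[R]_(r, n)) (B : 'M[R]_(m, n)) (lambda p gamma : R) :
    'cV[R]_n -> \bar R :=
  fun x => (obj_phi f A x + (lambda * capped_sum p gamma (B *m x))%:E)%E.

(* Main.v *)
(* The functions Psi_gamma need not be level bounded, since A may have a kernel.
   However, if phi(x) <= M then x can be replaced by a point x' of a fixed ball
   with A x' = A x, agreeing with x on the entries of B x where
   gamma |t|^p < 1; all other entries of B x already carry the maximal penalty
   1, so Psi_gamma(x') <= Psi_gamma(x).  The ball is uniform in gamma bounded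
   below, so each Psi_{gamma^k} has a minimizer in one and the same compact set.
   Since (x, k) |-> Psi_{gamma^k}(x) is jointly lower semicontinuous with limit
   Phi as k -> oo, and Psi_gamma <= Phi, limits of minimizers minimize Phi, and
   compactness of the ball gives convergence of the minimal values. *)
Require Import Defs.
From mathcomp Require Import all_boot all_order all_algebra.
From mathcomp Require Import all_classical all_reals all_analysis.
From mathcomp Require Import lra.
Set Implicit Arguments.
Unset Strict Implicit.
Unset Printing Implicit Defensive.
Import Order.TTheory GRing.Theory Num.Theory.
Import numFieldNormedType.Exports.
Local Open Scope classical_set_scope.
Local Open Scope ring_scope.

(** * Compact boxes and minima of lower semicontinuous functions *)

Lemma cvg_mxP (R : realType) (T : Type) (F : set_system T) (m n : nat)
    (X : T -> 'M[R]_(m, n)) (M : 'M[R]_(m, n)) :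
  Filter F -> (forall i j, (fun t => X t i j) @ F --> M i j) -> X @ F --> M.
Proof.
move=> FF XM S [P MP PS].
have : \forall t \near F, forall i j, P i j (X t i j).
  by do 2![apply: filter_forall => ?]; apply: XM; apply: MP.
by apply: filterS => t Pt; apply: PS => i j; apply: Pt.
Qed.

Lemma mulmx_continuous (R : realType) (m n q : nat) (A : 'M[R]_(m, n)) :
  continuous (fun x : 'M[R]_(n, q) => A *m x).
Proof.
move=> x; apply: (@cvg_mxP _ _ (nbhs x)) => i j.
under eq_fun do rewrite mxE.
rewrite mxE; apply: cvg_big => [|k _]; first exact: add_continuous.
by apply: cvgM; [exact: cvg_cst|exact: coord_continuous].
Qed.

Lemma compact_box (R : realType) (n : nat) (rho : R) :
  compact [set x : 'cV[R]_n | forall i, `|x i 0| <= rho].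
Proof.
have -> : [set x : 'cV[R]_n | forall i, `|x i 0| <= rho] =
    trmx @` [set v : 'rV[R]_n | forall i, [set` `[- rho, rho]] (v 0 i)].
  apply/seteqP; split => [x xr|_ [v vr <-]] /=.
    exists x^T; last exact: trmxK.
    by move=> i /=; rewrite in_itv /= mxE -ler_norml; exact: xr.
  by move=> i; move: (vr i); rewrite /= in_itv /= mxE -ler_norml.
apply: continuous_compact; last first.
  apply: (@rV_compact R n (fun=> [set` `[- rho, rho]])) => i.
  exact: segment_compact.
apply: continuous_subspaceT => v; apply: (@cvg_mxP _ _ (nbhs v)) => i j.
by under eq_fun do rewrite mxE; rewrite mxE; exact: coord_continuous.
Qed.

Lemma lte_real_between (R : realType) (l : R) (e : \bar R) :
  (l%:E < e)%E -> exists2 a : R, l < a & (a%:E < e)%E.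
Proof.
case: e => [e| |//].
  rewrite lte_fin => le; exists ((l + e) / 2); last rewrite lte_fin.
    by rewrite midf_lt.
  by rewrite midf_lt.
by move=> _; exists (l + 1); [rewrite ltrDl|rewrite ltry].
Qed.

(** If the infimum [l] were not attained, each point of [K] would have a neighbourhood on which [g]
    stays above some level larger than [l]. Compactness yields one such level for all of [K], which
    contradicts the choice of [l]. *)
Lemma lsc_compact_min (R : realType) (X : topologicalType) (K : set X)
    (g : X -> \bar R) (x0 : X) :
  compact K -> K x0 -> lower_semicontinuous g -> bounded_below g ->
  exists2 x, K x & forall y, K y -> (g x <= g y)%E.
Proof.
move=> cK Kx0 g_lsc [b gb].
set l := ereal_inf (g @` K).
have lg y : K y -> (l <= g y)%E by move=> Ky; apply: ereal_inf_lbound; exists y.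
have [[x Kx gx]|no] := pselect (exists2 x, K x & (g x <= l)%E).
  by exists x => // y Ky; exact: le_trans gx (lg y Ky).
have ltlg x : K x -> (l < g x)%E.
  by move=> Kx; rewrite ltNge; apply/negP => gx; apply: no; exists x.
have bl : (b%:E <= l)%E by apply: le_ereal_inf_tmp => _ [y _ <-].
have lfin : l \is a fin_num.
  rewrite fin_numE -ltNye -ltey (lt_le_trans _ bl) ?ltNyr//=.
  by apply: lt_le_trans (ltlg _ Kx0) _; rewrite leey.
(* The near-covering form of compactness, with the level [s] decreasing to [l] as parameter, does
   the work of a finite subcover. *)
have : \forall s \near (fine l)^'+, K `<=` [set x | (s%:E < g x)%E].
  have /compact_near_coveringP := cK; apply => x Kx.
  have := ltlg x Kx.
  rewrite -(fineK lfin) => /lte_real_between[a la /g_lsc[V xV Vg]].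
  near=> y s => /=; apply: (@lt_le_trans _ _ a%:E); first rewrite lte_fin.
    by near: s; apply: nbhs_right_lt.
  by apply/ltW/Vg; near: y.
move=> near_l.
have [s [ls sg]] : exists s, fine l < s /\ K `<=` [set x | (s%:E < g x)%E].
  near (fine l)^'+ => s; exists s; split; near: s => //.
  exact: nbhs_right_gt.
have : (l < s%:E)%E by rewrite -(fineK lfin) lte_fin.
move=> /ereal_inf_lt[_ [y Ky <-]]; rewrite ltNge => /negP[].
exact/ltW/sg.
Unshelve. all: by end_near. Qed.

(** * Moving points into a fixed box *)

Lemma le_l2norm (R : realType) (n : nat) (x : 'cV[R]_n) (i : 'I_n) :
  `|x i 0| <= l2norm x.
Proof.
rewrite /l2norm -sqrtr_sqr ler_wsqrtr// (bigD1 i)//= lerDl.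
by apply: sumr_ge0 => j _; exact: sqr_ge0.
Qed.

(* [x'] is the image of [N I *m x] under a generalized inverse of [N I], where
   [N I] keeps only the rows of [B] on which [x] is small: the entries of
   [N I *m x] are bounded and there are finitely many index sets [I]. *)
Lemma bounded_competitor (R : realType) (r m n : nat) (f : 'cV[R]_r -> \bar R)
    (A : 'M[R]_(r, n)) (B : 'M[R]_(m, n)) (M t : R) :
  level_bounded f ->
  exists rho : R, forall x, (f (A *m x) <= M%:E)%E ->
    exists x' : 'cV[R]_n, [/\ forall i, `|x' i 0| <= rho, A *m x' = A *m x
      & forall i, `|(B *m x) i 0| <= t -> (B *m x') i 0 = (B *m x) i 0].
Proof.
move=> /(_ M)[K fK].
(* [|K|] bounds the entries of [A *m x], by level boundedness; [|t|] bounds the entries of [B *m x]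
   kept by [I]. *)
pose C : R := `|K| + `|t|.
have C0 : 0 <= C by rewrite addr_ge0.
(* Rows outside [I] are zeroed instead of deleted, so the size of [N I] does not depend on [I]. *)
pose N (I : {set 'I_m}) := col_mx A (\matrix_(i, j) (B i j *+ (i \in I))).
pose bnd I : R := \sum_i \sum_j `|pinvmx (N I) i j| * C.
have bnd0 I : 0 <= bnd I by do 2![apply: sumr_ge0 => ? _]; rewrite mulr_ge0.
exists (\sum_I bnd I) => x Ax.
pose I := [set i | `|(B *m x) i 0| <= t]%SET.
have NxB (y : 'cV[R]_n) i : i \in I -> (N I *m y) (rshift r i) 0 = (B *m y) i 0.
  move=> iI; rewrite mul_col_mx col_mxEd !mxE.
  by apply: eq_bigr => j _; rewrite mxE iI.
have NNx : N I *m (pinvmx (N I) *m (N I *m x)) = N I *m x.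
  by rewrite mulmxA (mulmxA _ (N I)) mulmxKpV.
exists (pinvmx (N I) *m (N I *m x)); split.
- have NC j : `|(N I *m x) j 0| <= C.
    case: (split_ordP j) => [k ->|k ->].
      rewrite mul_col_mx col_mxEu (le_trans (le_l2norm _ _))//.
      rewrite (@le_trans _ _ `|K|) ?lerDl// (le_trans _ (ler_norm _))//.
      rewrite leNgt; apply/negP => /fK; rewrite ltNge => /negP; exact.
    have [kI|kI] := boolP (k \in I).
      rewrite NxB//; move: kI; rewrite inE => /le_trans -> //.
      by rewrite (le_trans (ler_norm _))// lerDr.
    rewrite mul_col_mx col_mxEd mxE big1 ?normr0// => j' _.
    by rewrite mxE (negbTE kI) mul0r.
  move=> i; rewrite (bigD1 I)//= ler_wpDr ?sumr_ge0//.
  rewrite /bnd (bigD1 i)//= ler_wpDr ?sumr_ge0//.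
    by move=> i' _; apply: sumr_ge0 => j _; rewrite mulr_ge0.
  rewrite mxE (le_trans (ler_norm_sum _ _ _))// ler_sum// => j _.
  by rewrite normrM ler_wpM2l.
- by move: NNx; rewrite !mul_col_mx => /eq_col_mx[].
- by move=> i ti; rewrite -!NxB ?NNx// inE.
Qed.

(** * Scalar penalties and the objectives built on them *)

(** With the scalar penalty [c] left free, [obj_Psi] is an instance by conversion and [obj_Phi] is
    the instance at [l0]. Semicontinuity at fixed gamma and passage to the limit then follow from
    one lemma. *)
Definition obj (R : realType) (r m n : nat) (f : 'cV[R]_r -> \bar R)
    (A : 'M[R]_(r, n)) (B : 'M[R]_(m, n)) (lambda : R) (c : R -> R) :
    'cV[R]_n -> \bar R :=
  fun x => (obj_phi f A x + (lambda * \sum_(i < m) c ((B *m x) i 0))%:E)%E.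

Definition l0 (R : realType) (s : R) : R := (s != 0)%:R.

Lemma obj_PhiE (R : realType) (r m n : nat) (f : 'cV[R]_r -> \bar R)
    (A : 'M[R]_(r, n)) (B : 'M[R]_(m, n)) (lambda : R) :
  obj_Phi f A B lambda = obj f A B lambda (@l0 R).
Proof.
apply/funext => x; rewrite /obj_Phi /obj /l0norm -sum1_card natr_sum.
rewrite big_mkcond /=; congr (_ + (_ * _)%:E)%E; apply: eq_bigr => i _.
by rewrite /l0 -topredE /=; case: ifP.
Qed.

Section capped_penalty.
Variables (R : realType) (p : R).
Hypothesis p_gt0 : 0 < p.

Lemma capped_ge0 g s : 0 <= g -> 0 <= capped p g s.
Proof. by move=> g0; rewrite le_min ler01 andbT mulr_ge0// powR_ge0. Qed.

Lemma capped_le1 g s : capped p g s <= 1.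
Proof. by rewrite ge_min lexx orbT. Qed.

Lemma capped_le_l0 g s : capped p g s <= l0 s.
Proof.
rewrite /l0; case: eqP => [->|_]; last exact: capped_le1.
by rewrite /capped normr0 powR0 ?gt_eqF// mulr0 ge_min lexx.
Qed.

(** Below level 1 the cap is invisible and the power can be inverted, so semicontinuity of the
    penalty reduces to continuity of the absolute value. *)
Lemma lt_capped g d s : 0 < g -> 0 <= d -> d < 1 ->
  (d < capped p g s) = ((d / g) `^ p^-1 < `|s|).
Proof.
move=> g0 d0 d1; rewrite lt_min d1 andbT mulrC -ltr_pdivrMr//.
have dg : d / g = ((d / g) `^ p^-1) `^ p.
  by rewrite -powRrM mulVf ?gt_eqF// powRr1// divr_ge0// ltW.
rewrite [in LHS]dg (leW_mono_in (le_mono_in (gt0_ltr_powR p_gt0)))//.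
by rewrite nnegrE powR_ge0.
Qed.

(** The threshold [w] depends on [h] only, which makes saturation uniform over all [g] above [h]. *)
Lemma capped_eq1 g h w s :
  0 <= h -> 0 <= w -> 1 <= h * w `^ p -> h <= g -> w <= `|s| ->
  capped p g s = 1.
Proof.
move=> h0 w0 hw hg ws; apply/min_idPr/(le_trans hw).
by rewrite ler_pM ?powR_ge0// ge0_ler_powR ?nnegrE ?(ltW p_gt0).
Qed.

Lemma capped_lsc g t d : 0 < g -> d < capped p g t ->
  \forall s \near t, d < capped p g s.
Proof.
move=> g0 dt; have [d0|d0] := ltP d 0.
  by near=> s; apply: lt_le_trans d0 _; rewrite capped_ge0// ltW.
have d1 : d < 1 by apply: lt_le_trans dt _; exact: capped_le1.
near=> s; rewrite lt_capped//; near: s.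
apply: (@cvgr_gt _ _ (nbhs t) _ _ `|t|); last by rewrite -lt_capped.
exact: norm_continuous.
Unshelve. all: by end_near. Qed.

(** If [t] is nonzero, the penalty equals 1 once [s] is at least half as large as [t] in absolute
    value and [gamma k] is large. If [t] is zero, [d] is negative and nonnegativity suffices. *)
Lemma capped_cvg_l0 (gamma : nat -> R) t d : gamma @ \oo --> +oo -> d < l0 t ->
  \forall s \near t & k \near \oo, d < capped p (gamma k) s.
Proof.
move=> gammay dt; have [d0|d0] := ltP d 0.
  near=> s k => /=; apply: lt_le_trans d0 _; rewrite capped_ge0//.
  by near: k; exact: cvgry_ge.
have t0 : 0 < `|t|.
  rewrite normr_gt0; move: dt; rewrite /l0; case: eqP => // _ /(le_lt_trans d0).
  by rewrite ltxx.
have w0 : 0 < `|t| / 2 by rewrite divr_gt0.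
near=> s k => /=; apply: (lt_le_trans dt).
rewrite (@capped_eq1 _ ((`|t| / 2) `^ p)^-1 (`|t| / 2)).
- by rewrite /l0 lern1 leq_b1.
- by rewrite invr_ge0 powR_ge0.
- exact: ltW.
- by rewrite mulVf// gt_eqF// powR_gt0.
- by near: k; exact: cvgry_ge.
- near: s; apply: (@cvgr_ge _ _ (nbhs t) _ _ `|t|).
    exact: norm_continuous.
  by rewrite ltr_pdivrMr// ltr_pMr// ltr1n.
Unshelve. all: by end_near. Qed.
End capped_penalty.

(** The filter [F] lets the penalty vary with the point: a constant family gives semicontinuity of
    each Psi, the family along [gamma] gives the joint lower bound by Phi. *)
Lemma obj_lsc (R : realType) (r m n : nat) (f : 'cV[R]_r -> \bar R)
    (A : 'M[R]_(r, n)) (B : 'M[R]_(m, n)) (lambda : R)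
    (T : Type) (F : set_system T) (FF : Filter F)
    (c : T -> R -> R) (c0 : R -> R)
    (x : 'cV[R]_n) (a : R) :
  0 < lambda -> lower_semicontinuous f ->
  (forall t d, d < c0 t -> \forall s \near t & k \near F, d < c k s) ->
  (a%:E < obj f A B lambda c0 x)%E ->
  \forall z \near x & k \near F, (a%:E < obj f A B lambda (c k) z)%E.
Proof.
move=> lambda_gt0 f_lsc c_lsc.
rewrite /obj -lteBlDr// -EFinB => /lte_real_between[a1].
set S := \sum_i _ => aS a1f.
(* The gap between [a1] and [a - lambda * S] is shared among the [m] penalty terms; dividing by
   [m.+1] also covers [m = 0]. *)
pose e := (a1 - (a - lambda * S)) / (lambda * m.+1%:R).
have e0 : 0 < e by rewrite divr_gt0 ?subr_gt0// mulr_gt0.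
have fA : \forall z \near x & k \near F, (a1%:E < f (A *m z))%E.
  have [V AxV Vf] := f_lsc _ _ a1f.
  near=> z k => /=; apply: Vf; near: z.
  exact: (@mulmx_continuous _ _ _ _ A x V AxV).
have cB : \forall z \near x & k \near F,
    forall i, c0 ((B *m x) i 0) - e < c k ((B *m z) i 0).
  apply: (@filter_forall _ _
    (fun i zk => c0 ((B *m x) i 0) - e < c zk.2 ((B *m zk.1) i 0))
    (filter_prod (nbhs x) F)) => i.
  have [[P Q] /= [xP FQ] PQ] : \forall s \near (B *m x) i 0 & k \near F,
      c0 ((B *m x) i 0) - e < c k s.
    by apply: c_lsc; rewrite ltrBlDr ltrDl.
  exists ((fun z => (B *m z) i 0) @^-1` P, Q) => /=.
    split=> //; have := @coord_continuous R m 1 i 0 (B *m x) P xP.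
    exact: mulmx_continuous.
  by move=> -[z k] /= [Pz Qk]; apply: (PQ (_, _)).
move: fA cB; apply: filterS2 => -[z k] /= a1z cz.
rewrite -lteBlDr// -EFinB.
apply: le_lt_trans a1z; rewrite lee_fin.
have sumS : lambda * (S - m%:R * e) <= lambda * \sum_i c k ((B *m z) i 0).
  rewrite ler_pM2l// /S -[m in m%:R]card_ord mulr_natl -sumr_const -sumrB.
  by rewrite ler_sum// => i _; exact/ltW/cz.
have em : lambda * (m%:R * e) <= a1 - (a - lambda * S).
  rewrite /e mulrA [_ * (_ / _)]mulrCA ler_piMr//.
    by rewrite subr_ge0 ltW.
  by rewrite ler_pdivrMr ?mul1r ?mulr_gt0// ler_pM2l// ler_nat.
by rewrite mulrBr in sumS; lra.
Unshelve. all: by end_near. Qed.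

(** * Minimizers of Psi and their limits *)

Section capped_objective.
Variables (R : realType) (r m n : nat) (f : 'cV[R]_r -> \bar R).
Variables (A : 'M[R]_(r, n)) (B : 'M[R]_(m, n)) (lambda p : R).
Hypotheses (lambda_gt0 : 0 < lambda) (p_gt0 : 0 < p).
Hypotheses (f_lsc : lower_semicontinuous f) (f_bdd : bounded_below f).

Local Notation Phi := (obj_Phi f A B lambda).
Local Notation Psi := (obj_Psi f A B lambda p).

Lemma obj_Psi_ge_phi g x : 0 < g -> (obj_phi f A x <= Psi g x)%E.
Proof.
move=> g0; rewrite leeDl// lee_fin mulr_ge0 ?(ltW lambda_gt0)//.
rewrite sumr_ge0// => i _.
by rewrite capped_ge0// ltW.
Qed.

Lemma obj_Psi_le_Phi g x : (Psi g x <= Phi x)%E.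
Proof.
rewrite obj_PhiE leeD2l// lee_fin ler_pM2l// ler_sum// => i _.
exact: capped_le_l0.
Qed.

Lemma obj_Psi_lsc g : 0 < g -> lower_semicontinuous (Psi g).
Proof.
move=> g0 x a ax.
have [|[P Q] /= [xP FQ] PQ] := @obj_lsc R r m n f A B lambda nat \oo _
  (fun=> capped p g) (capped p g) x a lambda_gt0 f_lsc _ ax.
  move=> t d /(capped_lsc p_gt0 g0) dt; near=> s k => /=; near: s; exact: dt.
have [k Qk] := filter_ex FQ.
by exists P => // y Py; exact: (PQ (y, k)).
Unshelve. all: by end_near. Qed.

Lemma obj_Psi_bdd g : 0 < g -> bounded_below (Psi g).
Proof.
move=> g0; have [b fb] := f_bdd; exists b => x.
exact: le_trans (fb _) (obj_Psi_ge_phi _ g0).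
Qed.

Lemma Psi_competitor (h M : R) : 0 < h -> level_bounded f ->
  exists rho : R, forall g x, h <= g -> (obj_phi f A x <= M%:E)%E ->
    exists2 x' : 'cV[R]_n, forall i, `|x' i 0| <= rho & (Psi g x' <= Psi g x)%E.
Proof.
move=> h0 f_lb.
(* The threshold solves h t^p = 1: beyond it the penalty is saturated for every [g] above [h]. *)
have [rho rhoP] := @bounded_competitor R r m n f A B M (h^-1 `^ p^-1) f_lb.
exists rho => g x hg /rhoP[x' [x'rho Ax' Bx']]; exists x' => //.
rewrite /obj_Psi /obj_phi Ax' leeD2l// lee_fin ler_pM2l// ler_sum// => i _.
have [xi|xi] := leP `|(B *m x) i 0| (h^-1 `^ p^-1); first by rewrite Bx'.
(* [B x'] may be arbitrary here, but the penalty at [x] is already maximal. *)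
rewrite (capped_eq1 p_gt0 (ltW h0) (powR_ge0 _ _) _ hg (ltW xi)) ?capped_le1//.
by rewrite -powRrM mulVf ?gt_eqF// powRr1 ?invr_ge0 ?(ltW h0)// divff// gt_eqF.
Qed.

Lemma argmin_Psi_box (h : R) : 0 < h -> level_bounded f -> no_ninfty f ->
    proper_fun (obj_phi f A) ->
  exists rho : R, forall g, h <= g ->
    exists2 x : 'cV[R]_n, forall i, `|x i 0| <= rho & argmin (Psi g) x.
Proof.
move=> h0 f_lb f_range [x0 x0y].
have x0fin : obj_phi f A x0 \is a fin_num by rewrite fin_numE f_range.
(* [M] bounds Psi at [x0] for every [g], so a point where phi exceeds [M] cannot beat [x0]; all
   other points have a competitor in the box. *)
pose M := fine (obj_phi f A x0) + lambda * m%:R.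
have PsiM g : (Psi g x0 <= M%:E)%E.
  rewrite /obj_Psi -(fineK x0fin) -EFinD lee_fin lerD2l ler_pM2l//.
  rewrite -[m in m%:R]card_ord -sum1_card natr_sum ler_sum// => i _.
  exact: capped_le1.
have x0M : (obj_phi f A x0 <= M%:E)%E.
  by rewrite -(fineK x0fin) lee_fin lerDl mulr_ge0// ltW.
have [rho rhoP] := @Psi_competitor h M h0 f_lb.
exists rho => g hg; have g0 := lt_le_trans h0 hg.
have [x0' x0'rho x0'x0] := rhoP g x0 hg x0M.
have [x xrho xmin] := lsc_compact_min (@compact_box R n rho) x0'rho
  (obj_Psi_lsc g0) (obj_Psi_bdd g0).
exists x => // y; have [yM|My] := leP (obj_phi f A y) M%:E.
  have [y' y'rho y'y] := rhoP g y hg yM.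
  exact: le_trans (xmin _ y'rho) y'y.
apply: le_trans (xmin _ x0'rho) _; apply: le_trans x0'x0 _.
apply: le_trans (PsiM g) _; apply: le_trans (ltW My) _.
exact: obj_Psi_ge_phi.
Qed.

Variable gamma : nat -> R.
Hypothesis gamma_cvgy : gamma @ \oo --> +oo.

Lemma obj_Psi_Phi_lsc x a : (a%:E < Phi x)%E ->
  \forall z \near x & k \near \oo, (a%:E < Psi (gamma k) z)%E.
Proof.
rewrite obj_PhiE.
apply: (@obj_lsc _ _ _ _ f A B _ _ _ _ (fun k => capped p (gamma k))) => // t d.
exact: capped_cvg_l0.
Qed.

(** Covers both subsequential limits and cluster points. If Phi were smaller at [y] than at [x],
    then near [x] and for large [k] Psi would exceed Phi at [y], hence Psi at [y], leaving no
    minimizer there. *)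
Lemma frequent_argmin x :
  (forall V Q, nbhs x V -> \oo Q ->
    exists k z, [/\ Q k, V z & argmin (Psi (gamma k)) z]) ->
  argmin Phi x.
Proof.
move=> xfreq y; rewrite leNgt; apply/negP => yx.
have yfin : Phi y \is a fin_num.
  rewrite fin_numE -ltNye -ltey (lt_le_trans yx) ?leey// andbT.
  have [b fb] := f_bdd; apply: lt_le_trans (ltNyr b) _.
  apply: le_trans (fb (A *m y)) _.
  rewrite obj_PhiE leeDl// lee_fin mulr_ge0 ?(ltW lambda_gt0)// sumr_ge0//.
move: yx; rewrite -(fineK yfin) => /obj_Psi_Phi_lsc[[V Q] /= [xV Qoo] VQ].
have [k [z [Qk Vz /(_ y)]]] := xfreq V Q xV Qoo.
rewrite leNgt => /negP[]; apply: le_lt_trans (obj_Psi_le_Phi _ _) _.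
by rewrite -(fineK yfin); exact: (VQ (z, k)).
Qed.

End capped_objective.

Theorem theorem4p4 (R : realType) (r m n : nat)
    (A : 'M[R]_(r, n)) (B : 'M[R]_(m, n)) (lambda p : R) (gamma : nat -> R)
    (f : 'cV[R]_r -> \bar R)
    (lambda_gt0 : 0 < lambda) (p_gt0 : 0 < p)
    (gamma_gt0 : forall k, 0 < gamma k)
    (gamma_incr : nondecreasing_seq gamma)
    (gamma_cvgy : gamma @ \oo --> +oo)
    (f_range : no_ninfty f) (f_proper : proper_fun f)
    (f_lsc : lower_semicontinuous f)
    (f_lb : level_bounded f) (f_bdd : bounded_below f)
    (phi_proper : proper_fun (obj_phi f A)) :
  [/\ (exists (u : nat -> \bar R) (v : \bar R),
        [/\ forall k, is_min (obj_Psi f A B lambda p (gamma k)) (u k),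
            is_min (obj_Phi f A B lambda) v
          & u @ \oo --> v]),
      outer_limit (fun k => argmin (obj_Psi f A B lambda p (gamma k)))
        `<=` argmin (obj_Phi f A B lambda)
    & forall x : nat -> 'cV[R]_n,
        (forall k, argmin (obj_Psi f A B lambda p (gamma k)) (x k)) ->
        cluster (x @ \oo) `<=` argmin (obj_Phi f A B lambda)].
Proof.
have freq := frequent_argmin lambda_gt0 p_gt0 f_lsc f_bdd gamma_cvgy.
have cluster_argmin (x : nat -> 'cV[R]_n) :
    (forall k, argmin (obj_Psi f A B lambda p (gamma k)) (x k)) ->
    cluster (x @ \oo) `<=` argmin (obj_Phi f A B lambda).
  move=> xmin y xy; apply: freq => V Q yV Qoo.
  have [|_ [[k Qk <-] Vxk]] := xy (x @` Q) V _ yV.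
    by apply: filterS Qoo => k Qk; exists k.
  by exists k, (x k).
split; last exact: cluster_argmin.
(* By monotonicity [gamma 0] bounds all [gamma k] from below, so one box serves every [k]. *)
- have [rho rhoP] := argmin_Psi_box B lambda_gt0 p_gt0 f_lsc f_bdd (gamma_gt0 0)
    f_lb f_range phi_proper.
  have /choice[x xP] k : exists x : 'cV[R]_n, (forall i, `|x i 0| <= rho) /\
      argmin (obj_Psi f A B lambda p (gamma k)) x.
    by have [x] := rhoP (gamma k) (gamma_incr _ _ (leq0n k)); exists x.
  have [|xb] := @compact_box R n rho (x @ \oo).
    by exists 0 => // k _; exact: (xP k).1.
  move=> [_ /(cluster_argmin x (fun k => (xP k).2)) xbmin].
  have [x0 x0y] := phi_proper; have [b fb] := f_bdd.
  have vub : (obj_Phi f A B lambda xb < +oo)%E.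
    by apply: le_lt_trans (xbmin x0) _; rewrite lte_add_pinfty ?ltry// ltey.
  have ulb k : (b%:E <= obj_Psi f A B lambda p (gamma k) (x k))%E.
    by apply: le_trans (fb (A *m x k)) _; exact: obj_Psi_ge_phi.
  have uv k : (obj_Psi f A B lambda p (gamma k) (x k) <=
      obj_Phi f A B lambda xb)%E.
    exact: le_trans ((xP k).2 xb) (obj_Psi_le_Phi _ _ _ _ _ _ _).
  have vfin : obj_Phi f A B lambda xb \is a fin_num.
    rewrite fin_numE -ltNye -ltey vub andbT (lt_le_trans (ltNyr b))//.
    exact: le_trans (ulb 0) (uv 0).
  have ufin k : obj_Psi f A B lambda p (gamma k) (x k) \is a fin_num.
    rewrite fin_numE -ltNye -ltey (le_lt_trans (uv k) vub) andbT.
    exact: lt_le_trans (ltNyr b) (ulb k).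
  exists (fun k => obj_Psi f A B lambda p (gamma k) (x k)),
    (obj_Phi f A B lambda xb).
  split.
  + move=> k; split; first by exists (x k).
    by move=> _ [y _ <-]; exact: (xP k).2.
  + by split; [exists xb|move=> _ [y _ <-]; exact: xbmin].
  + rewrite -(fineK vfin); apply/fine_cvgP; split; first by exists 0.
    apply/cvgrPdist_le => e e0.
    (* Compactness makes the joint lower bound uniform over the box, so it applies at the moving
       points [x k]; [uv] gives the opposite inequality. *)
    have : \forall k \near \oo,
        [set y : 'cV[R]_n | forall i, `|y i 0| <= rho] `<=`
        [set y | ((fine (obj_Phi f A B lambda xb) - e)%:E <
                  obj_Psi f A B lambda p (gamma k) y)%E].
      have /compact_near_coveringP := @compact_box R n rho; apply => y _.
      apply: obj_Psi_Phi_lsc => //; apply: lt_le_trans (xbmin y).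
      by rewrite -[ltRHS](fineK vfin) lte_fin ltrBlDr ltrDl.
    apply: filterS => k /(_ _ (xP k).1) /=.
    rewrite -(fineK (ufin k)) lte_fin => vek.
    have := uv k; rewrite -(fineK (ufin k)) -(fineK vfin) lee_fin => ukv.
    by rewrite ger0_norm ?subr_ge0//=; move: vek; lra.
- move=> x [s [u [s_incr umin ux]]]; apply: freq => V Q xV [N _ NQ].
  have sge j : (j <= s j)%N.
    by elim: j => // j /leq_ltn_trans; apply; exact: s_incr.
  have [M _ MV] := ux _ xV.
  exists (s (maxn N M)), (u (maxn N M)); split.
  + by apply: NQ => /=; exact: leq_trans (leq_maxl _ _) (sge _).
  + by apply: MV => /=; exact: leq_maxr.
  + exact: umin.
Qed.
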